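(* Let $B$ be a block graph of order $n$ with $s$ blocks such that some two cut vertices of $B$ do not belong to the same block. Let $C_B$ be the clique tree obtained from $B$ by replacing each block by a clique on the same vertex set, and let $\mathbb{S}(s-2,1)$ be the clique tree obtained from $C_B$ as described in the context. Then $$\lambda_1(D(B^c))\le \lambda_1(D(\mathbb{S}^c(s-2,1))),$$ with equality if and only if $B\cong \mathbb{S}(s-2,1)$.
   Context: All graphs are finite and simple. A cut vertex of a connected graph is a vertex whose deletion disconnects the graph. A block is a maximal connected subgraph having no cut vertex. A block graph here means a connected graph considered together with its blocks $B^1,\dots,B^s$ (the blocks need not be complete). A clique tree is a connected graph each of whose blocks is a clique; its blocks are called its cliques; an end clique is a clique containing exactly one cut vertex. For a graph $G$, $G^c$ denotes its complement; for a connected graph $H$, $D(H)$ is its distance matrix and $\lambda_1(D(H))$ its largest eigenvalue. The clique tree $\mathbb{S}(s-2,1)$ is obtained from the clique tree $C_B$ as follows: choose a clique $K$ containing two cut vertices $w$ and $w'$, and a clique $K'\neq K$ containing $w'$; then rearrange the cliques (keeping the orders of all cliques) so that the resulting clique tree, on $n$ vertices with $s$ cliques, has exactly two cut vertices $w$ and $w'$, $K$ contains both $w$ and $w'$, $K'$ is an end clique attached at $w'$ (the only clique other than $K$ containing $w'$), and the remaining $s-2$ cliques are end cliques attached at $w$.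
   Formalization: The choice of which cut vertex of K is called w cannot be arbitrary (the inequality can fail); it is proved for every clique K and every two cut vertices of K, suitably named w and w', and then for every clique K' ≠ K containing w'. *)

(* Defs.v *)
From mathcomp Require Import classical_sets reals.
From mathcomp Require Import all_boot all_order all_algebra.

Set Implicit Arguments.
Unset Strict Implicit.
Unset Printing Implicit Defensive.

Import Order.TTheory GRing.Theory Num.Theory.

Local Open Scope ring_scope.

Record graph (T : finType) := Graph {
  adj :> rel T;
  adj_sym : symmetric adj;
  adj_irr : irreflexive adj }.

Section Graphs.
Variables (T : finType) (G : graph T).

Lemma compl_sym : symmetric [rel x y : T | (x != y) && ~~ G x y].
Proof. by move=> x y /=; rewrite eq_sym adj_sym. Qed.

Lemma compl_irr : irreflexive [rel x y : T | (x != y) && ~~ G x y].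
Proof. by move=> x /=; rewrite eqxx. Qed.

Definition compl_graph : graph T := Graph compl_sym compl_irr.

Definition induced (W : {set T}) : rel T :=
  [rel x y | [&& x \in W, y \in W & G x y]].

Definition connected_in (W : {set T}) : bool :=
  [forall x in W, forall y in W, connect (induced W) x y].

Definition connected : bool := connected_in [set: T].

Definition cut_vertex_in (W : {set T}) (v : T) : bool :=
  (v \in W) && ~~ connected_in (W :\ v).

Definition cut_vertex (v : T) : bool := cut_vertex_in [set: T] v.

(* A maximal connected subgraph without cut vertex is an induced subgraph, as
   adding edges creates neither disconnection nor cut vertices; blocks are
   therefore represented by their vertex sets. *)
Definition blocks : {set {set T}} :=
  [set W | maxset [pred X : {set T} | connected_in X
             && [forall v in X, ~~ cut_vertex_in X v]] W].

Definition is_clique (W : {set T}) : bool :=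
  [forall x in W, forall y in W, (x != y) ==> G x y].

Definition clique_tree : bool :=
  connected && [forall W in blocks, is_clique W].

Definition end_clique (W : {set T}) : bool :=
  (W \in blocks) && (#|[set v in W | cut_vertex v]| == 1)%N.

Definition block_rel : rel T :=
  [rel x y | (x != y) && [exists W in blocks, (x \in W) && (y \in W)]].

Lemma block_rel_sym : symmetric block_rel.
Proof.
move=> x y; rewrite /block_rel /= eq_sym; congr (_ && _).
by apply: eq_existsb => W; rewrite [(x \in W) && _]andbC.
Qed.

Lemma block_rel_irr : irreflexive block_rel.
Proof. by move=> x; rewrite /block_rel /= eqxx. Qed.

(* C_G : every block of G is replaced by a clique on the same vertices. *)
Definition clique_tree_of : graph T := Graph block_rel_sym block_rel_irr.

(* The least k such that some walk of length k goes from x to y; it is smaller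
   than #|T| when x and y are connected, and equal to #|T| otherwise. *)
Definition gdist (x y : T) : nat :=
  find (fun k => [exists p : k.-tuple T, path G x p && (last x p == y)])
       (iota 0 #|T|).

Definition distance_mx (R : realType) : 'M[R]_#|T| :=
  \matrix_(i, j) (gdist (enum_val i) (enum_val j))%:R.

End Graphs.

(* For a real symmetric matrix of positive size the set of eigenvalues is
   finite and nonempty, so that this supremum is the largest eigenvalue. *)
Definition lambda1 (R : realType) (n : nat) (A : 'M[R]_n) : R :=
  sup [set a : R | eigenvalue A a]%classic.

Definition graph_iso (T U : finType) (G : graph T) (H : graph U) : Prop :=
  exists f : T -> U, bijective f /\ forall x y, H (f x) (f y) = G x y.

(* S is the clique tree S(s-2,1) obtained from the clique tree C (of order n,
   with s cliques) with the chosen cliques K and K'; the rearrangement of the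
   cliques is an order-preserving bijection phi from the cliques of C to those
   of S. *)
Definition is_S_s2_1 (n s : nat) (T U : finType) (C : graph T)
    (K K' : {set T}) (S : graph U) : Prop :=
  [/\ #|U| = n, clique_tree S, #|blocks S| = s
    & exists (phi : {set T} -> {set U}) (w w' : U),
      [/\ [/\ {in blocks C &, injective phi},
              phi @: blocks C = blocks S
            & forall Q, Q \in blocks C -> #|phi Q| = #|Q|],
          w != w' /\ [set v | cut_vertex S v] = [set w; w'],
          w \in phi K /\ w' \in phi K,
          [/\ end_clique S (phi K'), w' \in phi K'
            & forall Q, Q \in blocks S -> w' \in Q -> Q = phi K \/ Q = phi K']
        & (forall Q, Q \in blocks C -> Q != K -> Q != K' ->
              end_clique S (phi Q) /\ w \in phi Q)
          /\ #|[set Q in blocks S | end_clique S Q & w \in Q]| = (s - 2)%N]].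

(* Main.v *)
From mathcomp Require Import topology normedtype derive.
Require Import Defs.
From mathcomp Require Import classical_sets reals.
From mathcomp Require Import all_boot all_order all_algebra.
From mathcomp Require Import lra.

(** An edge of B dominating all vertices would contain every cut vertex of B,
    so B has no dominating edge and D(B^c) <= J - I + A(C_B) entrywise, while
    D(S^c) >= J - I + A(S) entrywise with an additional unit at (w, w'), as
    the edge w w' of S is dominating. Let xi be the positive Perron vector of
    D(B^c) and let r maximise xi. Root the block tree of C_B at r: each block Q
    has a root p Q, and every vertex other than r is a non-root vertex of
    exactly one block. Choose w' in {a, b} distinct from p K; then p K' = w'.
    Hanging every block other than K' at r instead of p Q turns C_B into S, and
    does not decrease xi^T A xi because xi r is maximal; the extra unit at
    (w, w') makes the inequality of Rayleigh quotients strict. Finally B and S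
    are never isomorphic, since S has a dominating edge. *)

Set Implicit Arguments.
Unset Strict Implicit.
Unset Printing Implicit Defensive.

Import Order.TTheory GRing.Theory Num.Theory.
Import numFieldNormedType.Exports.

Local Open Scope ring_scope.

(** * Rayleigh quotients and the largest eigenvalue *)

Section Rayleigh.
Variables (R : realType) (n : nat).
Implicit Types (A : 'M[R]_n) (u v : 'rV[R]_n).

Definition bilin A u v : R := (u *m A *m v^T) 0 0.

Lemma bilinDl A u1 u2 v : bilin A (u1 + u2) v = bilin A u1 v + bilin A u2 v.
Proof. by rewrite /bilin !mulmxDl mxE. Qed.

Lemma bilinDr A u v1 v2 : bilin A u (v1 + v2) = bilin A u v1 + bilin A u v2.
Proof. by rewrite /bilin linearD mulmxDr mxE. Qed.

Lemma bilinZl A c u v : bilin A (c *: u) v = c * bilin A u v.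
Proof. by rewrite /bilin -!scalemxAl mxE. Qed.

Lemma bilinZr A c u v : bilin A u (c *: v) = c * bilin A u v.
Proof. by rewrite /bilin linearZ -scalemxAr mxE. Qed.

Lemma bilinC A u v : A^T = A -> bilin A u v = bilin A v u.
Proof.
move=> symA; rewrite /bilin -[in RHS](trmxK (v *m A *m u^T)) [in RHS]mxE.
by rewrite !trmx_mul trmxK symA mulmxA.
Qed.

Lemma bilinE A u v : bilin A u v = \sum_i \sum_j A i j * u 0 i * v 0 j.
Proof.
rewrite /bilin mxE exchange_big; apply: eq_bigr => j _ /=.
rewrite !mxE mulr_suml; apply: eq_bigr => i _.
by rewrite [u 0 i * _]mulrC.
Qed.

Lemma bilin1E u v : bilin 1%:M u v = \sum_i u 0 i * v 0 i.
Proof. by rewrite /bilin mulmx1 mxE; apply: eq_bigr => i _; rewrite mxE. Qed.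

Lemma bilin1_ge0 u : 0 <= bilin 1%:M u u.
Proof. by rewrite bilin1E sumr_ge0 // => i _; rewrite -expr2 sqr_ge0. Qed.

Lemma bilin1_eq0 u : (bilin 1%:M u u == 0) = (u == 0).
Proof.
rewrite bilin1E psumr_eq0 => [|i _]; last by rewrite -expr2 sqr_ge0.
apply/allP/eqP => [u0|-> i _]; last by rewrite mxE mulr0 eqxx implybT.
apply/rowP => i; rewrite mxE; apply/eqP; rewrite -sqrf_eq0 expr2.
by have := u0 i (mem_index_enum i).
Qed.

Lemma bilin_continuous A : continuous (fun v => bilin A v v).
Proof.
rewrite (_ : (fun _ => _) = fun v => \sum_i \sum_j A i j * v 0 i * v 0 j);
  last by apply: boolp.funext => w; exact: bilinE.
apply: (@continuous_big R _ +%R 0 xpredT add_continuous) => i _.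
apply: (@continuous_big R _ +%R 0 xpredT add_continuous) => j _.
move=> v; have coordc k : {for v, continuous (fun v : 'rV[R]_n => v 0 k)}.
  exact: coord_continuous.
apply: (@continuousM R _ (fun v => A i j * v 0 i) (fun v => v 0 j)) => //.
apply: (@continuousM R _ (fun=> A i j) (fun v => v 0 i)) => //.
exact: cst_continuous.
Qed.

(** Closed as the preimage of 1 under a continuous form, and bounded because each squared coordinate
    is one term of a sum of squares equal to 1. *)
Lemma sphere_compact : compact [set v : 'rV[R]_n | bilin 1%:M v v = 1]%classic.
Proof.
apply: bounded_closed_compact; last first.
  have /continuous_closedP := @bilin_continuous 1%:M.
  by move=> /(_ [set x | x = 1]%classic); apply; exact: closed_eq.
exists 1; split=> [|M M1 v /= v1]; first exact: real1.
apply: le_trans (ltW M1).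
rewrite [leLHS]mx_normrE; apply/bigmax_leP; split=> // -[i j] _ /=.
rewrite (ord1 i) -(expr_le1 (_ : 0 < 2)%N) // real_normK ?num_real //.
rewrite -v1 bilin1E (bigD1 j) //= -expr2 lerDl sumr_ge0 // => k _.
by rewrite -expr2 sqr_ge0.
Qed.

(** The form attains its maximum [L] on the compact unit sphere; rescaling a nonzero [y] to the
    sphere extends the bound to all vectors. *)
Lemma rayleigh_max A : (0 < n)%N ->
  exists2 x, x != 0
    & exists L, bilin A x x = L * bilin 1%:M x x
                /\ forall y, bilin A y y <= L * bilin 1%:M y y.
Proof.
move=> n_gt0; pose e : 'rV[R]_n := delta_mx 0 (Ordinal n_gt0).
have e1 : bilin 1%:M e e = 1.
  rewrite bilin1E (bigD1 (Ordinal n_gt0)) //= mxE !eqxx mulr1 big1 ?addr0 //.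
  by move=> i /negPf ni; rewrite mxE ni mul0r.
have [x + maxx] : exists2 c, c \in [set v | bilin 1%:M v v = 1]%classic
    & forall t, t \in [set v | bilin 1%:M v v = 1]%classic
      -> bilin A t t <= bilin A c c.
  apply: compact_EVT_max sphere_compact _; first by exists e.
  by apply: continuous_subspaceT; exact: bilin_continuous.
move=> /set_mem /= x1; exists x.
  by rewrite -bilin1_eq0 x1 oner_eq0.
exists (bilin A x x); rewrite x1 mulr1; split=> // y.
have [->|y_neq0] := eqVneq y 0.
  by rewrite /bilin !mul0mx mxE mulr0.
have y_gt0 : 0 < bilin 1%:M y y by rewrite lt_def bilin1_ge0 bilin1_eq0 y_neq0.
pose c := (Num.sqrt (bilin 1%:M y y))^-1.
have c2 : c * c = (bilin 1%:M y y)^-1.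
  by rewrite -invfM -expr2 sqr_sqrtr // ltW.
have cy1 : bilin 1%:M (c *: y) (c *: y) = 1.
  by rewrite bilinZl bilinZr mulrA c2 mulVf ?lt0r_neq0.
have := maxx (c *: y) (mem_set cy1); rewrite bilinZl bilinZr mulrA c2.
by rewrite mulrC ler_pdivrMr.
Qed.

(** A nonnegative form that vanishes at [x] has [x] as a minimiser, so its first variation there
    vanishes in every direction [z]; the direction [x *m A] then has norm 0. *)
Lemma psd_kernel A (x : 'rV[R]_n) : A^T = A -> (forall y, 0 <= bilin A y y) ->
  bilin A x x = 0 -> x *m A = 0.
Proof.
move=> symA psdA x0.
have orth z : bilin A x z = 0.
  set b := bilin A x z; set c := bilin A z z.
  have c_ge0 : 0 <= c by exact: psdA.
  (* The displacement is nearly the minimiser [- b / c] along [z]; the added 1 keeps the denominator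
     positive when [c] is 0, and the form there is negative unless [b] is 0. *)
  have := psdA (x + (- b / (c + 1)) *: z).
  rewrite bilinDl !bilinDr !bilinZl !bilinZr x0 (bilinC z x symA) -/b -/c.
  set t := _ / _; have tc : t * (c + 1) = - b by rewrite divfK // gt_eqF ?ltr_wpDl.
  by move=> ge0; nra.
have := orth (x *m A); rewrite /bilin -{1}[x *m A]mulmx1.
by move/eqP; rewrite -/(bilin _ _ _) bilin1_eq0 => /eqP.
Qed.

Lemma lambda1_eq A (x : 'rV[R]_n) L : x != 0 -> x *m A = L *: x ->
  (forall y, bilin A y y <= L * bilin 1%:M y y) -> lambda1 A = L.
Proof.
move=> x_neq0 xA maxL; rewrite /lambda1.
have eigL : eigenvalue A L by apply/eigenvalueP; exists x.
have ubL : ubound [set a : R | eigenvalue A a]%classic L.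
  move=> a /= /eigenvalueP[v vA v_neq0].
  have v_gt0 : 0 < bilin 1%:M v v.
    by rewrite lt_def bilin1_ge0 bilin1_eq0 v_neq0.
  rewrite -(ler_pM2r v_gt0); apply: le_trans (maxL v).
  by rewrite /bilin vA -!scalemxAl mulmx1 [leRHS]mxE.
apply/eqP; rewrite eq_le ge_sup //=; last by exists L.
by apply: ub_le_sup => //; exists L.
Qed.

(** The matrix [L%:M - A] is positive semidefinite and its form vanishes at [x], so [psd_kernel]
    applies. *)
Lemma rayleigh_eigen A (x : 'rV[R]_n) L : A^T = A ->
  (forall y, bilin A y y <= L * bilin 1%:M y y) ->
  bilin A x x = L * bilin 1%:M x x -> x *m A = L *: x.
Proof.
move=> symA maxL xL; apply/esym/eqP.
rewrite -mul_mx_scalar -subr_eq0 -mulmxBr; apply/eqP.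
have LBE y : bilin (L%:M - A) y y = L * bilin 1%:M y y - bilin A y y.
  rewrite /bilin mulmxBr mulmxBl mxE [X in _ + X]mxE; congr (_ - _).
  by rewrite mul_mx_scalar mulmx1 -scalemxAl [LHS]mxE.
apply: psd_kernel => [|y|]; first by rewrite linearB /= tr_scalar_mx symA.
  by rewrite LBE subr_ge0.
by rewrite LBE xL subrr.
Qed.

Lemma lambda1_rayleigh A : (0 < n)%N -> A^T = A ->
  (exists2 x : 'rV[R]_n, x != 0 & x *m A = lambda1 A *: x)
  /\ forall y, bilin A y y <= lambda1 A * bilin 1%:M y y.
Proof.
move=> n_gt0 symA; have [x x_neq0 [L [xL maxL]]] := rayleigh_max A n_gt0.
have xA : x *m A = L *: x by exact: rayleigh_eigen.
by rewrite (@lambda1_eq A x L) //; split=> //; exists x.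
Qed.

(** Taking absolute values in a top eigenvector does not decrease the form, as the entries of [A]
    are nonnegative; the result is again a maximiser, hence an eigenvector. The diagonal may vanish,
    as it does for distance matrices. *)
Lemma perron A : (0 < n)%N -> A^T = A -> (forall i j, 0 <= A i j) ->
  (forall i j, i != j -> 0 < A i j) ->
  exists2 x : 'rV[R]_n, forall i, 0 < x 0 i
    & bilin A x x = lambda1 A * bilin 1%:M x x.
Proof.
move=> n_gt0 symA A_ge0 A_gt0.
have [[z z_neq0 zA] maxA] := lambda1_rayleigh n_gt0 symA.
pose x : 'rV[R]_n := \row_i `|z 0 i|.
have x1 : bilin 1%:M x x = bilin 1%:M z z.
  rewrite !bilin1E; apply: eq_bigr => i _.
  by rewrite mxE -normrM -expr2 ger0_norm ?sqr_ge0.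
have xA : bilin A x x = lambda1 A * bilin 1%:M x x.
  apply/eqP; rewrite eq_le maxA x1 /=.
  have -> : lambda1 A * bilin 1%:M z z = bilin A z z.
    by rewrite /bilin zA mulmx1 -scalemxAl [RHS]mxE.
  rewrite !bilinE; apply: ler_sum => i _; apply: ler_sum => j _.
  rewrite !mxE -!mulrA ler_wpM2l //.
  by rewrite -normrM ler_norm.
exists x => // i.
have xL : x *m A = lambda1 A *: x by exact: rayleigh_eigen.
rewrite lt_def mxE normr_ge0 andbT normr_eq0.
apply: contra z_neq0 => /eqP zi0; apply/eqP/rowP => j; rewrite mxE.
have [->//|ji] := eqVneq j i.
(* At a zero coordinate [i] the eigenvalue equation makes a sum of nonnegative terms vanish; since
   [A j i] is positive, coordinate [j] vanishes too. *)
have /rowP/(_ i)/eqP := xL; rewrite !mxE zi0 normr0 mulr0.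
rewrite psumr_eq0 => [/allP/(_ j (mem_index_enum j))/=|k _].
  by rewrite mulf_eq0 (gt_eqF (A_gt0 _ _ ji)) orbF mxE normr_eq0 => /eqP.
by rewrite mxE mulr_ge0.
Qed.

End Rayleigh.

(** * Blocks and the rooted block tree *)

Section Connectivity.
Variables (T : finType) (G : graph T).
Implicit Types (X Y W Q : {set T}) (x y z v : T) (p : seq T).

Lemma connected_inP W :
  reflect {in W &, forall x y, connect (induced G W) x y} (connected_in G W).
Proof.
by apply: (iffP forall_inP) => conW x; [move=> y xW yW|move=> xW];
  [move/forall_inP: (conW x xW); apply | apply/forall_inP => y; exact: conW].
Qed.

Lemma connect_induced_sym W : connect_sym (induced G W).
Proof.
by apply: sym_connect_sym => x y; rewrite /induced /= adj_sym andbCA.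
Qed.

Lemma connect_induced_mono X Y x y : X \subset Y ->
  connect (induced G X) x y -> connect (induced G Y) x y.
Proof.
move=> /subsetP sXY; apply: connect_sub => {x y} x y /and3P[xX yX Gxy].
by apply: connect1; rewrite /induced /= !sXY.
Qed.

Lemma path_connect_induced W x p z : path G x p -> {subset x :: p <= W} ->
  z \in x :: p -> connect (induced G W) z (last x p).
Proof.
elim: p x z => [|y p IHp] x z /=; first by rewrite inE => _ _ /eqP->.
move=> /andP[Gxy yp] sW; have sW' : {subset y :: p <= W}.
  by move=> t tp; apply: sW; rewrite inE tp orbT.
rewrite inE => /predU1P[->|]; last exact: IHp.
apply: connect_trans _ (IHp y y yp sW' (mem_head _ _)).
by apply: connect1; rewrite /induced /= Gxy !sW // !inE eqxx ?orbT.
Qed.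

Lemma connected_in_subsingleton W : {in W &, forall x y, x = y} ->
  connected_in G W.
Proof. by move=> W1; apply/connected_inP => x y xW yW; rewrite (W1 x y). Qed.

Lemma connected_inU X Y z : connected_in G X -> connected_in G Y ->
  z \in X -> z \in Y -> connected_in G (X :|: Y).
Proof.
move=> /connected_inP cX /connected_inP cY zX zY.
have toz x : x \in X :|: Y -> connect (induced G (X :|: Y)) x z.
  case/setUP => [xX|xY]; [apply: connect_induced_mono (cX _ _ xX zX)
                         |apply: connect_induced_mono (cY _ _ xY zY)].
    exact: subsetUl.
  exact: subsetUr.
apply/connected_inP => x y /toz xz /toz yz; apply: connect_trans xz _.
by rewrite connect_induced_sym.
Qed.

Lemma connected_in_path x p : path G x p -> connected_in G [set z in x :: p].
Proof.
move=> xp; have tolast z : z \in x :: p ->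
    connect (induced G [set z in x :: p]) z (last x p).
  by apply: path_connect_induced => // t tp; rewrite inE.
apply/connected_inP => y z; rewrite !inE => /tolast ylast /tolast zlast.
by apply: connect_trans ylast _; rewrite connect_induced_sym.
Qed.

Lemma connected_inU_path X z x p : connected_in G X -> path G x p ->
  z \in X -> z \in x :: p -> connected_in G (X :|: [set t in x :: p]).
Proof.
move=> cX xp zX zp; apply: connected_inU cX (connected_in_path xp) zX _.
by rewrite inE.
Qed.

Lemma setD1_notin W v : v \notin W -> W :\ v = W.
Proof. by move=> vW; rewrite (setDidPl _) // disjoint_sym disjoints1. Qed.

(* Single vertices and edges count as 2-connected. *)
Definition two_connected W : bool :=
  connected_in G W && [forall v in W, ~~ cut_vertex_in G W v].

Lemma two_connectedP W :
  reflect (connected_in G W /\ forall v, connected_in G (W :\ v))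
          (two_connected W).
Proof.
apply: (iffP andP) => [[cW /forall_inP ncut]|[cW cWv]]; split=> //.
  move=> v; have [vW|vW] := boolP (v \in W).
    by have := ncut v vW; rewrite /cut_vertex_in vW negbK.
  by rewrite setD1_notin.
by apply/forall_inP => v vW; rewrite /cut_vertex_in cWv andbF.
Qed.

Lemma blockP Q : reflect
  (two_connected Q /\ forall W, two_connected W -> Q \subset W -> W = Q)
  (Q \in blocks G).
Proof. by rewrite inE; apply: maxsetP. Qed.

Lemma two_connected_block W : two_connected W ->
  exists2 Q, Q \in blocks G & W \subset Q.
Proof.
by move=> /(maxset_exists (P := two_connected)) [Q maxQ sWQ];
  exists Q; rewrite // inE.
Qed.

Lemma two_connected1 x : two_connected [set x].
Proof.
apply/two_connectedP; split=> [|v]; apply: connected_in_subsingleton => y z.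
  by rewrite !inE => /eqP-> /eqP->.
by rewrite !inE => /andP[_ /eqP->] /andP[_ /eqP->].
Qed.

Lemma two_connected_edge x y : G x y -> two_connected [set x; y].
Proof.
move=> Gxy.
have cxy : connected_in G [set x; y].
  have -> : [set x; y] = [set z in [:: x; y]] by apply/setP => z; rewrite !inE.
  by apply: connected_in_path; rewrite /= Gxy.
apply/two_connectedP; split=> // v.
have [vxy|vxy] := boolP (v \in [set x; y]); last first.
  by rewrite setD1_notin.
apply: connected_in_subsingleton => s t; move: vxy.
rewrite !inE => /orP[]/eqP-> /andP[/negPf sv sxy] /andP[/negPf tv txy].
  by move: sxy txy; rewrite sv tv => /eqP-> /eqP->.
by move: sxy txy; rewrite sv tv !orbF => /eqP-> /eqP->.
Qed.

Lemma vertex_block x : exists2 Q, Q \in blocks G & x \in Q.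
Proof.
have [Q bQ] := two_connected_block (two_connected1 x).
by rewrite sub1set => xQ; exists Q.
Qed.

Lemma edge_block x y : G x y ->
  exists2 Q, Q \in blocks G & (x \in Q) && (y \in Q).
Proof.
move=> /two_connected_edge/two_connected_block[Q bQ].
by rewrite subUset !sub1set; exists Q.
Qed.

Lemma block_neq0 Q x : Q \in blocks G -> exists y, y \in Q.
Proof.
case/blockP => _ maxQ; apply/set0Pn/eqP => Q0.
have := maxQ _ (two_connected1 x); rewrite Q0 => /(_ (sub0set _))/setP/(_ x).
by rewrite !inE eqxx.
Qed.

(** Two 2-connected sets that share [y] and are joined by a path avoiding [y] form a ring. Without
    [y] the path still links them; without any other [v] they still meet at [y]. *)
Lemma two_connectedU_path Q Q' y x p :
  two_connected Q -> two_connected Q' -> y \in Q -> y \in Q' ->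
  x \in Q -> last x p \in Q' -> path G x p -> uniq (x :: p) ->
  y \notin x :: p -> two_connected (Q :|: Q' :|: [set z in x :: p]).
Proof.
move=> /two_connectedP[cQ cQv] /two_connectedP[cQ' cQv'] yQ yQ' xQ x'Q'.
move=> xp uxp yxp.
have x_neq_y : x != y by apply: contraNneq yxp => <-; rewrite mem_head.
have x'_neq_y : last x p != y by apply: contraNneq yxp => <-; rewrite mem_last.
apply/two_connectedP; split=> [|v].
  apply: (@connected_inU_path _ x); rewrite ?inE ?xQ ?eqxx //.
  exact: connected_inU yQ yQ'.
have [->|v_neq_y] := eqVneq v y.
  have -> : (Q :|: Q' :|: [set z in x :: p]) :\ y =
      (Q :\ y :|: [set z in x :: p]) :|: Q' :\ y.
    apply/setP => z; rewrite !inE; have [->|] := eqVneq z y => //=.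
      by rewrite inE in yxp; rewrite (negPf yxp).
    by case: (z \in Q); case: (z \in Q'); rewrite ?orbT ?orbF.
  apply: (@connected_inU _ _ (last x p)); rewrite ?inE ?x'_neq_y ?mem_last //.
    by apply: (@connected_inU_path _ x); rewrite ?inE ?eqxx ?x_neq_y.
  by move: (mem_last x p); rewrite inE => ->; rewrite orbT.
have cX : connected_in G (Q :\ v :|: Q' :\ v).
  by apply: (@connected_inU _ _ y); rewrite ?inE 1?eq_sym ?v_neq_y.
have [vp|vp] := boolP (v \in x :: p); last first.
  have -> : (Q :|: Q' :|: [set z in x :: p]) :\ v =
      (Q :\ v :|: Q' :\ v) :|: [set z in x :: p].
    by rewrite !setDUl [X in _ :|: X]setD1_notin ?inE.
  apply: (@connected_inU_path _ x); rewrite ?mem_head // !inE xQ andbT.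
  by apply/orP; left; apply: contraNneq vp => <-; rewrite mem_head.
(* Removing [v] from the path leaves two pieces: [p1], if nonempty, hangs on [Q] at [x], and [p2],
   if nonempty, hangs on [Q'] at [last x p]. *)
have [p1 [p2 def_xp]] : exists p1 p2, x :: p = p1 ++ v :: p2.
  by case/splitPr: vp => p1 p2; exists p1, p2.
move: uxp; rewrite def_xp cat_uniq /= negb_or => /and4P[_ /andP[vp1 _] vp2 _].
have -> : (Q :|: Q' :|: [set z in p1 ++ v :: p2]) :\ v =
    (Q :\ v :|: Q' :\ v) :|: [set z in p1] :|: [set z in p2].
  apply/setP => z; rewrite !inE mem_cat inE.
  have [->|] := eqVneq z v; first by rewrite (negPf vp1) (negPf vp2).
  by rewrite /= !orbA.
have cX1 : connected_in G ((Q :\ v :|: Q' :\ v) :|: [set z in p1]).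
  case: p1 def_xp vp1 => [|x1 p1]; first by rewrite set_nil setU0.
  move=> [<- def_p]; rewrite inE negb_or => /andP[v_neq_x _].
  apply: (@connected_inU_path _ x); rewrite ?mem_head //.
    by move: xp; rewrite def_p cat_path => /andP[].
  by rewrite !inE xQ eq_sym v_neq_x.
case: p2 def_xp vp2 => [|z p2] def_xp; first by rewrite set_nil setU0.
move=> vp2; have def_x' : last x p = last z p2.
  by rewrite -[LHS]/(last x (x :: p)) def_xp last_cat.
apply: (@connected_inU_path _ (last z p2)); rewrite ?mem_last //.
  case: p1 def_xp {cX1 vp1} => [|x1 p1] [def_x def_p].
    by move: xp; rewrite def_p /= => /andP[].
  by move: xp; rewrite def_p cat_path /= => /and3P[_ _ /andP[]].
rewrite !inE -def_x' x'Q' andbT (_ : last x p != v) ?orbT //.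
by rewrite def_x'; apply: contraNneq vp2 => <-; rewrite mem_last.
Qed.

(** A walk from [x] to [x'] avoiding [y] shortens to a simple path, whose union with both blocks is
    2-connected; by maximality each block equals that union. *)
Lemma block_eq Q Q' x x' y : Q \in blocks G -> Q' \in blocks G ->
  y \in Q -> y \in Q' -> x \in Q -> x' \in Q' -> x != y -> x' != y ->
  connect (induced G [set~ y]) x x' -> Q = Q'.
Proof.
move=> /blockP[tQ maxQ] /blockP[tQ' maxQ'] yQ yQ' xQ + x_neq_y _.
move=> x'Q' /connectP[p0 xp0 def_x']; move: x'Q'; rewrite {x'}def_x'.
case/shortenP: xp0 => p xp uxp _ x'Q'.
have sub_p : all (mem [set~ y]) p.
  elim: p {uxp x'Q'} x {xQ x_neq_y} xp => //= z p IHp x.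
  by move=> /andP[/and3P[_ zy _] /IHp]; rewrite zy.
have Gxp : path G x p by apply: sub_path xp => s t /and3P[].
have yp : y \notin x :: p.
  rewrite inE negb_or eq_sym x_neq_y; apply/negP => /(allP sub_p).
  by rewrite /= !inE eqxx.
have tW := two_connectedU_path tQ tQ' yQ yQ' xQ x'Q' Gxp uxp yp.
have sQ : Q \subset Q :|: Q' :|: [set z in x :: p] by rewrite -setUA subsetUl.
rewrite -[LHS](maxQ _ tW sQ); apply: maxQ' tW _.
by rewrite setUAC subsetUr.
Qed.

Lemma connect_path_notin x p y : path G x p -> y \notin x :: p ->
  connect (induced G [set~ y]) x (last x p).
Proof.
move=> xp yp; apply: path_connect_induced xp _ (mem_head _ _) => z zp.
by rewrite !inE; apply: contraNneq yp => <-.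
Qed.

Hypothesis G_conn : connected G.
Variable r : T.

Lemma connected_path x :
  exists p, [/\ path G x p, last x p = r & uniq (x :: p)].
Proof.
have /connected_inP/(_ x r) := G_conn; rewrite !inE => /(_ isT isT)/connectP.
case=> p0 + ->; case/shortenP=> p xp uxp _; exists p; split=> //.
by apply: sub_path xp => s t /and3P[].
Qed.

(* The root of a block Q is its vertex nearest to r. *)
Definition nonroot Q y : Prop :=
  exists x, [/\ x \in Q, x != y & connect (induced G [set~ y]) x r].

Lemma nonroot_neq Q y : nonroot Q y -> y != r.
Proof.
case=> x [_ x_neq_y]; apply: contraTneq => y_eq_r.
rewrite {}y_eq_r in x_neq_y *.
rewrite connect_induced_sym; apply/connectP => -[[|z p] /=].
  by move=> _ xr; rewrite xr eqxx in x_neq_y.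
by rewrite /induced /= !inE eqxx.
Qed.

(** Both blocks reach [r] without using [y], so they are joined by a walk through [r] that avoids
    [y]. *)
Lemma nonroot_block_uniq Q Q' y : Q \in blocks G -> Q' \in blocks G ->
  y \in Q -> y \in Q' -> nonroot Q y -> nonroot Q' y -> Q = Q'.
Proof.
move=> bQ bQ' yQ yQ' [x [xQ xy xr]] [x' [xQ' xy' xr']].
apply: (@block_eq _ _ x x' y) => //; apply: connect_trans xr _.
by rewrite connect_induced_sym.
Qed.

(** The block is the one containing the first edge of a simple path from [y] to [r]; the rest of the
    path avoids [y]. *)
Lemma nonroot_block y : y != r ->
  exists Q, [/\ Q \in blocks G, y \in Q & nonroot Q y].
Proof.
move=> y_neq_r; have [[|z p] [/= yp lastr]] := connected_path y.
  by rewrite lastr eqxx in y_neq_r.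
move: yp => /andP[Gyz zp] /andP[yzp _].
have [Q bQ /andP[yQ zQ]] := edge_block Gyz; exists Q; split=> //; exists z.
split=> //; last by rewrite -lastr; exact: connect_path_notin.
by apply: contraNneq yzp => ->; rewrite mem_head.
Qed.

(** A simple path from [y] to [r] either avoids [y'], which makes [y'] a non-root, or passes through
    it; then its tail from [y'] avoids [y], contradicting that [y] is a root. *)
Lemma block_root_uniq Q y y' : y \in Q -> y' \in Q -> y != y' ->
  ~ nonroot Q y -> nonroot Q y'.
Proof.
move=> yQ y'Q y_neq root_y; have [p [yp lastr uyp]] := connected_path y.
have [y'p|y'p] := boolP (y' \in y :: p); last first.
  by exists y; split=> //; rewrite -lastr; exact: connect_path_notin.
case: root_y; exists y'; rewrite eq_sym; split=> //.
move: y'p yp lastr uyp; rewrite inE eq_sym (negPf y_neq) /= => y'p.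
case/splitPr: y'p => p1 p2; rewrite cat_path last_cat /=.
move=> /and3P[_ _ y'p2] <- /andP[+ _]; rewrite mem_cat negb_or => /andP[_ yp2].
exact: connect_path_notin.
Qed.

(** A path to [r] is followed while it stays in [Q]. If it stops at [r], that is the root. If it
    leaves along an edge from [x], then [x] is the root: otherwise the block of that edge would
    coincide with [Q]. *)
Lemma block_root Q : Q \in blocks G -> exists2 y, y \in Q & ~ nonroot Q y.
Proof.
move=> bQ; have [x0 x0Q] := block_neq0 r bQ.
have [p0 [+ + +]] := connected_path x0.
elim: p0 x0 x0Q => [|z p IHp] x xQ /= xp lastr uxp.
  by exists x => // /nonroot_neq; rewrite lastr eqxx.
move: xp uxp => /andP[Gxz zp] /andP[xzp uzp].
have [zQ|zQ] := boolP (z \in Q); first exact: IHp zQ zp lastr uzp.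
exists x => // nrx; have [Q' bQ' /andP[xQ' zQ']] := edge_block Gxz.
suff QQ' : Q = Q' by rewrite QQ' zQ' in zQ.
apply: nonroot_block_uniq bQ bQ' xQ xQ' nrx _; exists z; split=> //.
  by apply: contraNneq xzp => ->; rewrite mem_head.
by rewrite -lastr; exact: connect_path_notin.
Qed.

(** The rooted tree in functional form: [p] sends a block to its root and [q] sends a vertex other
    than [r] to the one block where it is not the root. *)
Lemma block_tree : exists (p : {set T} -> T) (q : T -> {set T}),
  [/\ forall Q, Q \in blocks G -> p Q \in Q,
      forall y, y != r -> [/\ q y \in blocks G, y \in q y & y != p (q y)]
    & forall Q y, Q \in blocks G -> y \in Q -> y != p Q ->
        y != r /\ q y = Q].
Proof.
have /fin_all_exists[p pP] : forall Q, exists y,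
    Q \in blocks G -> y \in Q /\ ~ nonroot Q y.
  move=> Q; have [bQ|_] := boolP (Q \in blocks G); last by exists r.
  by have [y] := block_root bQ; exists y.
have /fin_all_exists[q qP] : forall y, exists Q,
    y != r -> [/\ Q \in blocks G, y \in Q & nonroot Q y].
  move=> y; have [_|yr] := eqVneq y r; first by exists set0.
  by have [Q] := nonroot_block yr; exists Q.
exists p, q; split=> [Q /pP[]//|y /qP[bQ yQ nry]|Q y bQ yQ y_neq].
  by split=> //; apply/eqP => yp; have [_] := pP _ bQ; rewrite -yp.
have [pQ rootp] := pP _ bQ.
have nry : nonroot Q y by apply: block_root_uniq rootp; rewrite // eq_sym.
have yr := nonroot_neq nry; split=> //; have [bq yq nrq] := qP _ yr.
exact: nonroot_block_uniq nrq nry.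
Qed.

End Connectivity.

(** * Distances in the complement *)

Section Distance.
Variables (T : finType) (G : graph T).

Lemma gdist_le x p : path G x p -> (gdist G x (last x p) <= size p)%N.
Proof.
move=> xp; rewrite leqNgt; apply/negP => lt_p.
have p_T : (size p < #|T|)%N.
  by apply: leq_trans lt_p _; rewrite -[leqRHS](size_iota 0) find_size.
have := before_find 0%N lt_p; rewrite nth_iota // add0n => /existsP[].
by exists (in_tuple p); rewrite xp eqxx.
Qed.

(** The bound on [k] accounts for the value [#|T|] that [gdist] takes when no walk exists, so
    disconnected complements are handled uniformly. *)
Lemma gdist_gt k x y : (k < #|T|)%N ->
  (forall p, path G x p -> last x p = y -> (k < size p)%N) ->
  (k < gdist G x y)%N.
Proof.
move=> k_T walk_gt; rewrite ltnNge; apply/negP => dist_le.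
have dist_T : (gdist G x y < #|T|)%N by apply: leq_ltn_trans k_T.
pose a k := [exists p : k.-tuple T, path G x p && (last x p == y)].
have /(nth_find 0%N) : has a (iota 0 #|T|) by rewrite has_find size_iota.
rewrite -[find _ _]/(gdist G x y) nth_iota // add0n => /existsP[p /andP[xp /eqP lastp]].
by have := walk_gt p xp lastp; rewrite size_tuple ltnNge dist_le.
Qed.

Lemma gdistC x y : gdist G x y = gdist G y x.
Proof.
apply: eq_find => k; suff walkC (a b : T) :
    [exists p : k.-tuple T, path G a p && (last a p == b)] ->
    [exists p : k.-tuple T, path G b p && (last b p == a)].
  by apply/idP/idP; exact: walkC.
case/existsP=> p /andP[ap /eqP <-].
have sz : size (rev (belast a p)) == k by rewrite size_rev size_belast size_tuple.
apply/existsP; exists (Tuple sz) => /=; rewrite rev_path.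
rewrite (eq_path (e' := G)) ?ap => [|s t]; last exact: adj_sym.
by case: {+}(tval p) => //= c p'; rewrite rev_cons last_rcons eqxx.
Qed.

Lemma gdist_refl x : gdist G x x = 0%N.
Proof. by have := gdist_le (x := x) (p := [::]) isT; rewrite leqn0 => /eqP. Qed.

Lemma gdist_gt0 x y : x != y -> (0 < gdist G x y)%N.
Proof.
move=> xy; apply: gdist_gt => [|[_ /= xy'|]//]; first by apply/card_gt0P; exists x.
by rewrite xy' eqxx in xy.
Qed.

End Distance.

Section ComplementDistance.
Variables (T : finType) (G : graph T).

Definition dominating x y :=
  forall z, [|| z == x, z == y, G x z | G y z].

(** A vertex missed by an edge is a common neighbour of its ends in the complement. The boolean
    [G x y] counts as 0 or 1, so the bound is 1 for a non-edge and 2 for an edge. *)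
Lemma compl_gdist_le x y : x != y -> ~ (G x y /\ dominating x y) ->
  (gdist (compl_graph G) x y <= 1 + G x y)%N.
Proof.
move=> xy ndom; have [Gxy|nGxy] := boolP (G x y); last first.
  by apply: (@gdist_le _ (compl_graph G) x [:: y]); rewrite /= xy nGxy.
have /existsP[z] : [exists z, ~~ [|| z == x, z == y, G x z | G y z]].
  by rewrite -negb_forall; apply/negP => /forallP dom; apply: ndom.
rewrite !negb_or => /and4P[zx zy Gxz Gyz].
apply: (@gdist_le _ (compl_graph G) x [:: z; y]).
by rewrite /= eq_sym zx Gxz zy adj_sym Gyz.
Qed.

Lemma compl_gdist_ge x y : x != y -> (1 + G x y <= gdist (compl_graph G) x y)%N.
Proof.
move=> xy; have [Gxy|_] := boolP (G x y); last exact: gdist_gt0.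
apply: gdist_gt => [|[|z []]//=]; last 1 first.
- by move=> /andP[/andP[_ nGxz] _] zy; rewrite -zy in Gxy; rewrite Gxy in nGxz.
- by apply/card_gt1P; exists x, y.
by move=> _ /eqP; rewrite (negPf xy).
Qed.

(** The midpoint of a walk of length 2 in the complement would be a vertex that the edge fails to
    dominate. *)
Lemma compl_gdist_dominating x y : (2 < #|T|)%N -> G x y -> dominating x y ->
  (2 < gdist (compl_graph G) x y)%N.
Proof.
move=> T_gt2 Gxy dom; have xy : x != y.
  by apply: contraTneq Gxy => ->; rewrite adj_irr.
apply: gdist_gt => // -[|z [|t []]] //=.
- by move=> _ /eqP; rewrite (negPf xy).
- by rewrite andbT => /andP[_ nG] zy; rewrite -zy in Gxy; rewrite Gxy in nG.
rewrite andbT => /andP[/andP[xz Gxz] /andP[zy Gzy]] ty; rewrite {}ty in zy Gzy.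
have := dom z; rewrite eq_sym (negPf xz) (negPf zy) (negPf Gxz).
by rewrite adj_sym (negPf Gzy).
Qed.

End ComplementDistance.

(** * Distance spectra as quadratic forms in functions on the vertices *)

Section DistanceSpectrum.
Variables (R : realType) (T : finType).

Definition row_of_fun (f : T -> R) : 'rV[R]_#|T| := \row_i f (enum_val i).

Lemma sum_enum_val (f : T -> R) : \sum_(i < #|T|) f (enum_val i) = \sum_x f x.
Proof.
rewrite [RHS](reindex (enum_val (A := T))) //.
exact/onW_bij/enum_val_bij.
Qed.

Lemma bilin_distance_mx (G : graph T) f :
  bilin (distance_mx G R) (row_of_fun f) (row_of_fun f) =
  \sum_x \sum_y (gdist G x y)%:R * f x * f y.
Proof.
rewrite bilinE -sum_enum_val; apply: eq_bigr => i _.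
by rewrite -sum_enum_val; apply: eq_bigr => j _; rewrite !mxE.
Qed.

Lemma bilin1_row_of_fun f :
  bilin 1%:M (row_of_fun f) (row_of_fun f) = \sum_x f x * f x.
Proof.
by rewrite bilin1E -sum_enum_val; apply: eq_bigr => i _; rewrite !mxE.
Qed.

Lemma distance_mx_sym (G : graph T) : (distance_mx G R)^T = distance_mx G R.
Proof. by apply/matrixP => i j; rewrite !mxE gdistC. Qed.

Lemma distance_lambda1_ge (G : graph T) (f : T -> R) : (0 < #|T|)%N ->
  \sum_x \sum_y (gdist G x y)%:R * f x * f y
    <= lambda1 (distance_mx G R) * \sum_x f x * f x.
Proof.
move=> T_gt0; rewrite -bilin_distance_mx -bilin1_row_of_fun.
by have [_] := lambda1_rayleigh T_gt0 (distance_mx_sym G); apply.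
Qed.

Lemma distance_perron (G : graph T) : (0 < #|T|)%N ->
  exists2 f : T -> R, forall x, 0 < f x
    & \sum_x \sum_y (gdist G x y)%:R * f x * f y
        = lambda1 (distance_mx G R) * \sum_x f x * f x.
Proof.
move=> T_gt0.
have [||x x_gt0 xL] := perron T_gt0 (distance_mx_sym G).
- by move=> i j; rewrite mxE ler0n.
- move=> i j ij; rewrite mxE ltr0n gdist_gt0 //.
  by apply: contra_neq ij; exact: enum_val_inj.
exists (fun y => x 0 (enum_rank y)) => //.
rewrite -bilin_distance_mx -bilin1_row_of_fun.
suff -> : row_of_fun (fun y => x 0 (enum_rank y)) = x by [].
by apply/rowP => i; rewrite mxE enum_valK.
Qed.

End DistanceSpectrum.

(** Carrying [xi] along [f] turns a weight on one graph into a test vector for another. *)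
Lemma distance_lambda1_ge_bij (R : realType) (T U : finType) (G : graph U)
    (xi : T -> R) (f : T -> U) : bijective f -> (0 < #|T|)%N ->
  \sum_x \sum_y (gdist G (f x) (f y))%:R * xi x * xi y
    <= lambda1 (distance_mx G R) * \sum_x xi x * xi x.
Proof.
move=> f_bij T_gt0; have [g fK gK] := f_bij.
have U_gt0 : (0 < #|U|)%N by rewrite -(bij_eq_card f_bij).
have sumf (h : U -> R) : \sum_u h u = \sum_x h (f x).
  by rewrite (reindex f) //; exact: onW_bij.
have := distance_lambda1_ge G (xi \o g) U_gt0; rewrite !sumf.
under eq_bigr do rewrite sumf; under [in leRHS]eq_bigr do rewrite /= fK.
rewrite [leLHS](_ : _ =
  \sum_x \sum_y (gdist G (f x) (f y))%:R * xi x * xi y) //.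
by apply: eq_bigr => x _; apply: eq_bigr => y _; rewrite /= !fK.
Qed.

(** Both sets are enumerated and matched by position, with [a] and [b] placed first when both are
    present. *)
Lemma pointed_surjection (T U : finType) (A : {set T}) (B : {set U}) a b :
  #|A| = #|B| -> exists2 g : T -> U,
    {subset B <= [set g x | x in A]} /\ {in A, forall x, g x \in B}
    & a \in A -> b \in B -> g a = b.
Proof.
have surj (s : seq T) (t : seq U) c : size s = size t -> uniq s -> uniq t ->
    {in t, forall u, exists2 x, x \in s & nth c t (index x s) = u}
    /\ {in s, forall x, nth c t (index x s) \in t}.
  move=> sz us ut; split=> [u ut'|x xs]; last by rewrite mem_nth // -sz index_mem.
  have lt_u : (index u t < size s)%N by rewrite sz index_mem.
  case: s us sz lt_u => // x0 s us sz lt_u.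
  exists (nth x0 (x0 :: s) (index u t)); first exact: mem_nth.
  by rewrite index_uniq // nth_index.
move=> AB; have [/andP[aA bB]|nab] := boolP ((a \in A) && (b \in B)); last first.
  have [] := surj (enum A) (enum B) b; rewrite ?enum_uniq -?cardE //.
  move=> g1 g2; exists (fun x => nth b (enum B) (index x (enum A))).
    split=> [u|x xA]; last by have := g2 x; rewrite !mem_enum; apply.
    rewrite -mem_enum => /g1[x]; rewrite mem_enum => xA <-.
    exact: imset_f.
  by move=> aA bB; rewrite aA bB in nab.
have [|||g1 g2] := surj (a :: enum (A :\ a)) (b :: enum (B :\ b)) b.
- by rewrite /= -!cardE; apply/eqP; rewrite eqSS -(eqn_add2l 1);
    move: AB; rewrite (cardsD1 a A) (cardsD1 b B) aA bB => ->.
- by rewrite /= enum_uniq mem_enum !inE eqxx.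
- by rewrite /= enum_uniq mem_enum !inE eqxx.
have memA x : (x \in a :: enum (A :\ a)) = (x \in A).
  by rewrite inE mem_enum !inE; case: eqP => //= ->.
have memB x : (x \in b :: enum (B :\ b)) = (x \in B).
  by rewrite inE mem_enum !inE; case: eqP => //= ->.
eexists (fun x => nth b (b :: enum (B :\ b)) (index x (a :: enum (A :\ a)))).
  split=> [u|x]; last by rewrite -memA -memB; exact: g2.
  by rewrite -memB => /g1[x]; rewrite memA => xA <-; exact: imset_f.
by rewrite /= eqxx.
Qed.

(** Deleting a vertex off a dominating edge leaves everything attached to that edge. So [u] and [v]
    would both be ends of the edge, hence adjacent, and would share a block. *)
Lemma not_dominating_edge (T : finType) (G : graph T) u v x y :
  u != v -> cut_vertex G u -> cut_vertex G v ->
  (forall W, W \in blocks G -> ~ (u \in W /\ v \in W)) ->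
  G x y -> ~ dominating G x y.
Proof.
move=> uv cu cv sep Gxy dom.
have cut_xy c : cut_vertex G c -> c = x \/ c = y.
  rewrite /cut_vertex /cut_vertex_in inE /=.
  have [->|cx] := eqVneq c x; first by left.
  have [->|cy] := eqVneq c y; first by right.
  case/negP; set W := _ :\ c.
  have xW : x \in W by rewrite !inE eq_sym cx.
  have yW : y \in W by rewrite !inE eq_sym cy.
  have xyW : connect (induced G W) x y.
    by apply: connect1; rewrite /induced /= xW yW.
  have xzW z : z \in W -> connect (induced G W) x z.
    move=> zW; have /or4P[/eqP->//|/eqP->//|Gxz|Gyz] := dom z.
      by apply: connect1; rewrite /induced /= xW zW.
    by apply: connect_trans xyW (connect1 _); rewrite /induced /= yW zW.
  apply/connected_inP => s t /xzW xs /xzW xt.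
  by apply: connect_trans xt; rewrite connect_induced_sym.
have Guv : G u v.
  case: (cut_xy u cu) (cut_xy v cv) uv => -> [] ->; rewrite ?eqxx //.
  by rewrite adj_sym.
have [Q bQ /andP[uQ vQ]] := edge_block Guv.
exact: sep bQ (conj uQ vQ).
Qed.

Lemma graph_iso_dominating (T U : finType) (G : graph T) (H : graph U) w w' :
  graph_iso G H -> H w w' -> dominating H w w' ->
  exists x y, G x y /\ dominating G x y.
Proof.
case=> f [[g fK gK] fP] Hww dom; exists (g w), (g w'); split.
  by rewrite -fP !gK.
by move=> z; have := dom (f z); rewrite -!fP !gK !(can2_eq fK gK).
Qed.

Lemma block_rel_connected (T : finType) (G : graph T) :
  connected G -> connected (clique_tree_of G).
Proof.
move=> /connected_inP cG; apply/connected_inP => x y xT yT.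
have := cG x y xT yT; apply: connect_sub => s t /and3P[sT tT Gst].
apply: connect1; rewrite /induced /= sT tT /= /block_rel /=.
apply/andP; split; first by apply: contraTneq Gst => ->; rewrite adj_irr.
have [Q bQ stQ] := edge_block Gst.
by apply/existsP; exists Q; rewrite bQ.
Qed.

Lemma clique_adj (T : finType) (G : graph T) W x y :
  is_clique G W -> x \in W -> y \in W -> x != y -> G x y.
Proof.
move=> /forall_inP clW xW yW.
by move/forall_inP: (clW x xW) => /(_ y yW)/implyP.
Qed.

Lemma cut_vertex_card_gt2 (T : finType) (G : graph T) v :
  cut_vertex G v -> (2 < #|T|)%N.
Proof.
rewrite /cut_vertex /cut_vertex_in inE /=; apply: contraNltn => T_le2.
have /card_le1_eqP W1 : (#|[set: T] :\ v| <= 1)%N.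
  by move: T_le2; rewrite -cardsT (cardsD1 v) inE.
by apply: connected_in_subsingleton => x y xW yW; exact: W1.
Qed.

(** * Rearranging the blocks *)

Section Rearrangement.
Variables (T U : finType) (C : graph T) (S : graph U).
(* c is the cut vertex of C shared by K and K', to be sent to w'. *)
Variables (phi : {set T} -> {set U}) (K K' : {set T}) (r c : T) (w w' : U).
Variables (p : {set T} -> T) (q : T -> {set T}).

Hypothesis cardTU : #|T| = #|U|.
Hypothesis phi_blocks : phi @: blocks C = blocks S.
Hypothesis phi_card : forall Q, Q \in blocks C -> #|phi Q| = #|Q|.
Hypothesis phi_clique : forall Q, Q \in blocks C -> is_clique S (phi Q).
Hypothesis w_phi : forall Q, Q \in blocks C -> Q != K' -> w \in phi Q.
Hypothesis w_neq : w != w'.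
Hypothesis w'K : w' \in phi K.
Hypothesis w'K' : w' \in phi K'.
Hypothesis bK : K \in blocks C.
Hypothesis bK' : K' \in blocks C.
Hypothesis K'_neq : K' != K.
Hypothesis cK : c \in K.
Hypothesis cK' : c \in K'.
Hypothesis c_neq : c != p K.
Hypothesis p_in : forall Q, Q \in blocks C -> p Q \in Q.
Hypothesis q_in : forall y, y != r ->
  [/\ q y \in blocks C, y \in q y & y != p (q y)].
Hypothesis q_uniq : forall Q y, Q \in blocks C -> y \in Q -> y != p Q ->
  y != r /\ q y = Q.

Let c_neq_r : c != r. Proof. by have [] := q_uniq bK cK c_neq. Qed.
Let q_c : q c = K. Proof. by have [] := q_uniq bK cK c_neq. Qed.

(** Were [c] a non-root vertex of [K'], its unique block [q c] would be [K'] as well as [K]. *)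
Let p_K' : p K' = c.
Proof.
apply/eqP/negPn/negP; rewrite eq_sym => /(q_uniq bK' cK')[_].
by rewrite q_c => KK'; case/eqP: (K'_neq).
Qed.

(** The parent of [y] after the rearrangement, in place of [p (q y)]; [hubU] gives the corresponding
    attaching vertex in [S]. *)
Let hub y := if q y == K' then c else r.
Let hubU Q := if Q == K' then w' else w.

(** Each block without its root is mapped onto its image under [phi] without the attaching vertex.
    The pieces, with [r] sent to [w], fit into one map that covers [U], and equal cardinals make it
    bijective. *)
Lemma rearrangement : exists f : T -> U,
  [/\ bijective f, f r = w, f c = w'
    & forall y, y != r -> f y \in phi (q y)].
Proof.
have hubU_in Q : Q \in blocks C -> hubU Q \in phi Q.
  by rewrite /hubU; case: eqP => [-> //|/eqP QK' bQ]; exact: w_phi.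
have /fin_all_exists[g gP] Q : exists g : T -> U, Q \in blocks C ->
    [/\ {subset phi Q :\ hubU Q <= [set g x | x in Q :\ p Q]},
        {in Q :\ p Q, forall x, g x \in phi Q}
      (* This clause takes effect only for [K], the single block in which [c] is not the root. *)
      & c \in Q :\ p Q -> w' \in phi Q :\ hubU Q -> g c = w'].
  have [bQ|_] := boolP (Q \in blocks C); last by exists (fun=> w).
  have [|g [g1 g2] g3] :=
      @pointed_surjection _ _ (Q :\ p Q) (phi Q :\ hubU Q) c w'.
    apply/eqP; rewrite -(eqn_add2l 1); have := phi_card bQ.
    by rewrite (cardsD1 (p Q) Q) (cardsD1 (hubU Q)) p_in // hubU_in // => ->.
  by exists g; split=> // x /g2; rewrite inE => /andP[].
pose f y := if y == r then w else g (q y) y.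
have f_r : f r = w by rewrite /f eqxx.
have f_c : f c = w'.
  rewrite /f (negPf c_neq_r) q_c; have [_ _] := gP K bK; apply.
    by rewrite !inE c_neq.
  by rewrite !inE w'K /hubU [K == _]eq_sym (negPf K'_neq) eq_sym w_neq.
have f_in y : y != r -> f y \in phi (q y).
  move=> yr; have [bq yq yp] := q_in yr; rewrite /f (negPf yr).
  by have [_ + _] := gP _ bq; apply; rewrite !inE yp.
exists f; split=> //; apply: inj_card_bij; last by rewrite cardTU.
suff fT : f @: [set: T] = [set: U].
  have /imset_injP f_inj : #|f @: [set: T]| == #|[set: T]|.
    by rewrite fT !cardsT cardTU.
  by move=> x y; apply: f_inj; rewrite inE.
apply/setP => u; rewrite [RHS]inE; apply/imsetP.
have surj Q : Q \in blocks C -> u \in phi Q -> u != hubU Q ->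
    exists2 x, x \in [set: T] & u = f x.
  move=> bQ uQ uh; have [/(_ u) + _ _] := gP Q bQ.
  rewrite !inE uh uQ => /(_ isT)/imsetP[x]; rewrite !inE => /andP[xp xQ] ->.
  have [xr qx] := q_uniq bQ xQ xp; exists x; rewrite ?inE //.
  by rewrite /f (negPf xr) qx.
have [uw|uw] := eqVneq u w; first by exists r; rewrite ?inE ?f_r.
have [uw'|uw'] := eqVneq u w'; first by exists c; rewrite ?inE ?f_c.
have [Q' bQ' uQ'] := vertex_block S u.
move: bQ' uQ'; rewrite -phi_blocks => /imsetP[Q bQ ->] uQ.
by apply: surj bQ uQ _; rewrite /hubU; case: ifP.
Qed.

(** Adjacent pairs are either two non-root vertices of one block, kept by the rearrangement, or a
    parent and a child. Only the parents change, and the new parent is never lighter since [xi r] is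
    maximal. *)
Lemma quadratic_form_rearrangement (R : realType) (f : T -> U) (xi : T -> R) :
  bijective f -> f r = w -> f c = w' ->
  (forall y, y != r -> f y \in phi (q y)) ->
  (forall x, 0 <= xi x) -> (forall x, xi x <= xi r) ->
  \sum_x \sum_y (C x y)%:R * xi x * xi y
    <= \sum_x \sum_y (S (f x) (f y))%:R * xi x * xi y.
Proof.
move=> /bij_inj f_inj f_r f_c f_in xi_ge0 xi_max.
pose same x y := [&& x != r, y != r, x != y & q x == q y].
pose child (h : T -> T) x y := (y != r) && (x == h y).
have sum_child (h : T -> T) :
    \sum_x \sum_y (child h x y)%:R * xi x * xi y =
    \sum_(y | y != r) xi (h y) * xi y.
  rewrite exchange_big [RHS]big_mkcond; apply: eq_bigr => y _ /=.
  rewrite /child; have [->|yr] := eqVneq y r.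
    by rewrite big1 // => x _; rewrite !mul0r.
  rewrite (bigD1 (h y)) //= eqxx mul1r big1 ?addr0 // => x /negPf->.
  by rewrite !mul0r.
have sum_childC (h : T -> T) :
    \sum_x \sum_y (child h y x)%:R * xi x * xi y =
    \sum_(y | y != r) xi (h y) * xi y.
  rewrite -sum_child exchange_big; apply: eq_bigr => x _; apply: eq_bigr => y _.
  by rewrite -!mulrA [xi x * _]mulrC.
pose Phi h := \sum_x \sum_y (same x y)%:R * xi x * xi y +
  \sum_x \sum_y (child h x y)%:R * xi x * xi y +
  \sum_x \sum_y (child h y x)%:R * xi x * xi y.
have PhiE h : Phi h =
    \sum_x \sum_y (same x y + child h x y + child h y x)%:R * xi x * xi y.
  rewrite /Phi -!big_split; apply: eq_bigr => x _; rewrite -!big_split /=.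
  by apply: eq_bigr => y _; rewrite !natrD !mulrDl.
have hub_adj y : y != r -> S (f (hub y)) (f y).
  move=> yr; have [bq yq yp] := q_in yr.
  apply: clique_adj (phi_clique bq) _ (f_in _ yr) _.
    by rewrite /hub; case: eqP => [->|/eqP qK']; rewrite ?f_c // f_r w_phi.
  rewrite (inj_eq f_inj) /hub; case: ifP => [/eqP qK'|_]; last by rewrite eq_sym.
  by apply: contraNneq K'_neq => cy; rewrite -qK' -cy q_c.
(* Every edge of [C] lies in a block [Q]: either one end is [p Q], or both ends are non-root
   vertices with the same [q]. *)
apply: (@le_trans _ _ (Phi (p \o q))).
  rewrite PhiE; apply: ler_sum => x _; apply: ler_sum => y _.
  rewrite -!mulrA ler_wpM2r ?mulr_ge0 // ler_nat.
  have [Cxy|//] := boolP (C x y); have xy : x != y.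
    by apply: contraTneq Cxy => ->; rewrite adj_irr.
  have [Q bQ /andP[xQ yQ]] := edge_block Cxy.
  have [xp|xp] := eqVneq x (p Q).
    rewrite addnAC addnC; apply: leq_trans (leq_addr _ _).
    have [|yr qy] := q_uniq bQ yQ; first by rewrite -xp eq_sym.
    by rewrite /child yr /= qy xp eqxx.
  have [xr qx] := q_uniq bQ xQ xp; have [yp|yp] := eqVneq y (p Q).
    by rewrite addnC /child xr /= qx yp eqxx.
  have [yr qy] := q_uniq bQ yQ yp.
  by rewrite -addnA /same xr yr xy qx qy eqxx.
(* Children in [K'] keep the parent [c], which is [p K']; all other children get the parent [r]. *)
apply: (@le_trans _ _ (Phi hub)).
  rewrite /Phi !sum_child !sum_childC -!addrA lerD2l.
  suff le_hub : \sum_(y | y != r) xi ((p \o q) y) * xi y <=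
      \sum_(y | y != r) xi (hub y) * xi y by exact: lerD.
  apply: ler_sum => y yr; rewrite ler_wpM2r //= /hub.
  by case: eqP => // ->; rewrite p_K'.
rewrite PhiE; apply: ler_sum => x _; apply: ler_sum => y _.
rewrite -!mulrA ler_wpM2r ?mulr_ge0 // ler_nat.
(* The three indicators must exclude one another, because their sum is compared with a single 0-1
   entry of [S]. *)
have hub_same a b : same a b -> child hub a b = false.
  case/and4P=> ar br _ /eqP qab; rewrite /child br /= /hub -qab.
  case: ifP => [/eqP qK'|_]; last exact: negPf.
  by apply: contraNF K'_neq => /eqP ac; rewrite -qK' ac q_c.
have same_sym a b : same a b = same b a.
  by rewrite /same andbCA [a == b]eq_sym [q a == _]eq_sym.
have [sxy|nsxy] := boolP (same x y).
  rewrite hub_same // hub_same -1?same_sym //.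
  case/and4P: sxy => xr yr xy /eqP qxy; have [bq _ _] := q_in yr.
  rewrite (clique_adj (phi_clique bq)) ?f_in // -1?qxy ?f_in //.
  by rewrite (inj_eq f_inj).
rewrite add0n; have [/andP[yr /eqP xh]|nh] := boolP (child hub x y).
  (* If each were the parent of the other with neither equal to [r], then [x] would be [c] and [q x]
     would be [K'], whereas [q c] is [K]. *)
  have -> : child hub y x = false.
    apply/negP => /andP[xr /eqP yh].
    have qx : q x = K'.
      by move: yr; rewrite yh /hub; case: ifP => [/eqP|]; rewrite ?eqxx.
    have xc : x = c by move: xr; rewrite xh /hub; case: ifP; rewrite ?eqxx.
    by case/eqP: (K'_neq); rewrite -qx xc.
  by rewrite xh hub_adj.
have [/andP[xr /eqP yh]|//] := boolP (child hub y x).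
by rewrite yh adj_sym hub_adj.
Qed.

End Rearrangement.

(** * Comparison of the two largest eigenvalues *)

Theorem theorem5p2 (R : realType) (T : finType) (B : graph T) (n s : nat)
    (B_conn : connected B) (B_order : #|T| = n) (B_blocks : #|blocks B| = s)
    (B_cut : exists u v : T,
       [/\ u != v, cut_vertex B u, cut_vertex B v
         & forall W, W \in blocks B -> ~ (u \in W /\ v \in W)])
    (K : {set T}) (a b : T)
    (K_clique : K \in blocks (clique_tree_of B))
    (ab_neq : a != b)
    (aK : a \in K) (a_cut : cut_vertex (clique_tree_of B) a)
    (bK : b \in K) (b_cut : cut_vertex (clique_tree_of B) b) :
  exists w w' : T, [set w; w'] = [set a; b] /\
    forall K' : {set T},
      K' \in blocks (clique_tree_of B) -> K' != K -> w' \in K' ->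
    forall (U : finType) (S : graph U),
      is_S_s2_1 n s (clique_tree_of B) K K' S ->
      lambda1 (distance_mx (compl_graph B) R)
        <= lambda1 (distance_mx (compl_graph S) R)
      /\ (lambda1 (distance_mx (compl_graph B) R)
            = lambda1 (distance_mx (compl_graph S) R)
          <-> graph_iso B S).
Proof.
have [u [v [uv cut_u cut_v sep]]] := B_cut.
have B_ndom x y : ~ (B x y /\ dominating B x y).
  by case=> Bxy; exact: not_dominating_edge uv cut_u cut_v sep Bxy.
have T_gt2 := cut_vertex_card_gt2 cut_u.
have T_gt0 : (0 < #|T|)%N by apply: leq_trans T_gt2.
have [xi xi_gt0 xiB] := distance_perron R (compl_graph B) T_gt0.
have [r _ xi_max] := arg_maxP xi (isT : xpredT a).
set C := clique_tree_of B in K_clique a_cut b_cut *.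
have [p [q [p_in q_in q_uniq]]] := block_tree (block_rel_connected B_conn) r.
(* At most one of [a] and [b] is the root of [K]; the other serves as [c], the vertex to be sent to
   [w']. *)
have [c [d [cd cK c_neq]]] : exists c d,
    [/\ [set d; c] = [set a; b], c \in K & c != p K].
  have [ap|ap] := eqVneq a (p K); last by exists a, b; rewrite setUC.
  by exists b, a; split=> //; rewrite -ap eq_sym.
exists d, c; split=> // K' bK' K'_neq cK' U S.
case=> cardU /andP[_ /forall_inP S_cl] _ [phi [w [w' []]]].
case=> _ phi_bl phi_card [w_neq _] [wK w'K] [_ w'K' _] [w_end _].
have phi_cl Q : Q \in blocks C -> is_clique S (phi Q).
  by move=> bQ; apply: S_cl; rewrite -phi_bl imset_f.
have w_phi Q : Q \in blocks C -> Q != K' -> w \in phi Q.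
  move=> bQ QK'; have [->//|QK] := eqVneq Q K.
  by have [] := w_end Q bQ QK QK'.
have Sww : S w w' by exact: clique_adj (phi_cl _ K_clique) wK w'K w_neq.
(* Every vertex of [S] lies in a clique that contains [w'], if it is [phi K'], or [w] otherwise. *)
have S_dom : dominating S w w'.
  move=> z; have [zw|zw] := eqVneq z w => //; have [//|zw' /=] := eqVneq z w'.
  have [Q' + zQ'] := vertex_block S z.
  rewrite -phi_bl => /imsetP[Q bQ def_Q']; rewrite {}def_Q' in zQ'.
  have [QK'|QK'] := eqVneq Q K'.
    rewrite QK' in zQ'.
    by rewrite (clique_adj (phi_cl _ bK') w'K' zQ') ?orbT // eq_sym.
  by rewrite (clique_adj (phi_cl _ bQ) (w_phi Q bQ QK') zQ') // eq_sym.
have cardTU : #|T| = #|U| by rewrite cardU.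
have [f [f_bij f_r f_c f_in]] := rearrangement cardTU phi_bl phi_card w_phi
  w_neq w'K w'K' K_clique K'_neq cK c_neq p_in q_in q_uniq.
have xi_ge0 x : 0 <= xi x by exact: ltW.
have formCS := quadratic_form_rearrangement phi_cl w_phi w'K' K_clique bK'
  K'_neq cK cK' c_neq q_in q_uniq f_bij f_r f_c f_in xi_ge0
  (fun x => xi_max x isT).
have rc : r != c by rewrite -(inj_eq (bij_inj f_bij)) f_r f_c.
have sum_rc :
    \sum_x \sum_y ((x == r) && (y == c))%:R * xi x * xi y = xi r * xi c.
  rewrite (bigD1 r) //= (bigD1 c) //= !eqxx mul1r.
  rewrite big1 => [|y /negPf->]; last by rewrite andbF !mul0r.
  rewrite addr0 big1 ?addr0 // => x /negPf xr.
  by rewrite big1 // => y _; rewrite xr !mul0r.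
have lt_lambda : lambda1 (distance_mx (compl_graph B) R) <
    lambda1 (distance_mx (compl_graph S) R).
  have xi2_gt0 : 0 < \sum_x xi x * xi x.
    rewrite (bigD1 r) //= ltr_pwDl ?mulr_gt0 //.
    by apply: sumr_ge0 => x _; rewrite mulr_ge0.
  rewrite -(ltr_pM2r xi2_gt0) -xiB.
  apply: lt_le_trans (distance_lambda1_ge_bij (compl_graph S) xi f_bij T_gt0).
  (* The indicator of [x != y] is the matrix J - I, so the middle form belongs to J - I + A(C). *)
  apply: (@le_lt_trans _ _ (\sum_x \sum_y (x != y)%:R * xi x * xi y
    + \sum_x \sum_y (C x y)%:R * xi x * xi y)).
    rewrite -big_split; apply: ler_sum => x _; rewrite -big_split.
    apply: ler_sum => y _ /=; rewrite -!mulrDl -!mulrA -natrD.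
    rewrite ler_wpM2r ?mulr_ge0 // ler_nat.
    have [->|xy] := eqVneq x y; first by rewrite gdist_refl.
    apply: leq_trans (compl_gdist_le xy (@B_ndom x y)) _.
    rewrite leq_add2l; have [Bxy|//] := boolP (B x y).
    have [Q bQ xyQ] := edge_block Bxy.
    by rewrite /C /= /block_rel /= xy lt0b; apply/existsP; exists Q; rewrite bQ.
  (* Only the ordered pair [(r, c)] gets the extra unit; its weight [xi r * xi c] is positive, which
     already gives strictness. *)
  apply: (@lt_le_trans _ _ (\sum_x \sum_y (x != y)%:R * xi x * xi y
    + \sum_x \sum_y (S (f x) (f y))%:R * xi x * xi y
    + \sum_x \sum_y ((x == r) && (y == c))%:R * xi x * xi y)).
    rewrite sum_rc -addrA ltrD2l (le_lt_trans formCS) // ltrDl.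
    by rewrite mulr_gt0.
  rewrite -!big_split; apply: ler_sum => x _; rewrite -!big_split.
  apply: ler_sum => y _ /=; rewrite -!mulrDl -!mulrA -!natrD.
  rewrite ler_wpM2r ?mulr_ge0 // ler_nat.
  have [->|xy] := eqVneq x y.
    rewrite adj_irr; have [->|//] := eqVneq y r.
    by rewrite (negPf rc).
  have fxy : f x != f y by rewrite (inj_eq (bij_inj f_bij)).
  have [/andP[/eqP-> /eqP->]|_] := boolP ((x == r) && (y == c)).
    rewrite f_r f_c Sww; apply: compl_gdist_dominating => //.
    by rewrite -cardTU.
  by rewrite addn0 compl_gdist_ge.
split; first exact: ltW.
(* Both sides of the equivalence are false: equality contradicts the strict bound, and an
   isomorphism would give [B] a dominating edge. *)
split=> [eq_lambda|isoBS]; first by rewrite eq_lambda ltxx in lt_lambda.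
by have [x [y /B_ndom]] := graph_iso_dominating isoBS Sww S_dom.
Qed.
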